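(* For any $k\ge 1$, given any $\rho$-EFX full-information algorithm, the $\rho$-Virtual-EFX algorithm (defined in the context) makes $O(n+k\log m)$ value queries per agent and computes a $\frac{\rho}{2\,m^{1/(k+1)}}$-EFX allocation.
   Context: There is a set $N=\{1,\dots,n\}$ of $n\ge 2$ agents and a set $G$ of $m\ge n$ goods. Each agent $i$ has a valuation function $v_i:G\to\mathbb{R}_{\ge 0}$, extended additively to bundles: $v_i(X)=\sum_{g\in X}v_i(g)$ for $X\subseteq G$. An allocation is a tuple $(X_i)_{i\in N}$ of pairwise disjoint (possibly empty) bundles with $\bigcup_i X_i=G$. For $\alpha\in[0,1]$, an allocation is $\alpha$-EFX if for all agents $i\ne j$ with $X_j\ne\varnothing$ and every $g\in X_j$, $v_i(X_i)\ge\alpha\cdot v_i(X_j\setminus\{g\})$. The valuations are not known to the algorithm. It is given, for each agent $i$, a ranking (strict linear order) $\succ_i$ of $G$ consistent with $v_i$, i.e., $g\succ_i g'$ implies $v_i(g)\ge v_i(g')$. It may also make value queries, each of which names an agent $i$ and a good $g$ and returns $v_i(g)$. A $\rho$-EFX full-information algorithm is one that receives the complete valuation functions of all agents and returns an allocation that is $\rho$-EFX with respect to them. The $\rho$-Virtual-EFX algorithm, with parameter $k$ and a given $\rho$-EFX full-information algorithm used as a black box, works as follows. Set $\theta_\ell=m^{-\ell/(k+1)}$ for $\ell\in\{0,\dots,k\}$. For every agent $i$: (1) Query agent $i$ for the goods $g_{i,1},\dots,g_{i,n-1}$ that she ranks in the first $n-1$ positions (in this order), learning their values $v_{i,1},\dots,v_{i,n-1}$.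 (2) For each $\ell\in\{1,\dots,k\}$, run a binary search over the ranking (using value queries) to learn the set $S_{i,\ell}=\{g:\ v_{i,n-1}\cdot\theta_\ell\le v_i(g)<v_{i,n-1}\cdot\theta_{\ell-1}\}$. (3) Let $S_{i,k+1}$ be the set of remaining goods, i.e., those that are neither among $g_{i,1},\dots,g_{i,n-1}$ nor in $S_{i,1}\cup\dots\cup S_{i,k}$. (4) Define the additive virtual valuation $\tilde v_i$ by $\tilde v_i(g_{i,\ell})=v_{i,\ell}$ for $\ell\in\{1,\dots,n-1\}$; $\tilde v_i(g)=v_{i,n-1}\theta_\ell$ for $g\in S_{i,\ell}$ with $\ell\in\{1,\dots,k\}$; and $\tilde v_i(g)=0$ for $g\in S_{i,k+1}$. Finally, run the given $\rho$-EFX full-information algorithm on the virtual valuations $(\tilde v_i)_{i\in N}$ and return the allocation it outputs. The EFX guarantee in the claim is with respect to the true valuations $v_i$.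
   Formalization: Goods ranked after position n-1 whose value equals v_{i,n-1} are placed in S_{i,1} (the bound v_i(g) < v_{i,n-1}θ_0 is read as ''ranked after g_{i,n-1}''); with the strict inequality such goods get virtual value 0 and the claim fails, e.g. n=2, k=1, m=100, all values 1. *)

(* Defs.v *)
From mathcomp Require Import all_boot all_order all_algebra.
From mathcomp Require Import all_classical all_reals all_analysis.

Set Implicit Arguments.
Unset Strict Implicit.
Unset Printing Implicit Defensive.

Import Order.TTheory GRing.Theory Num.Theory.
Local Open Scope ring_scope.

(* Adaptive query programs: a program only sees its oracle through the answers
   to the queries it makes. [run] also returns the list of queries made, with
   repetitions. *)
Inductive qprog (Q A B : Type) : Type :=
| Ret of B
| Query of Q & (A -> qprog Q A B).

Arguments Ret {Q A B}.
Arguments Query {Q A B}.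

Fixpoint bind Q A B B' (p : qprog Q A B) (f : B -> qprog Q A B') :
    qprog Q A B' :=
  match p with
  | Ret b => f b
  | Query q c => Query q (fun a => bind (c a) f)
  end.

Fixpoint mapM Q A B T (f : T -> qprog Q A B) (s : seq T) : qprog Q A (seq B) :=
  if s is x :: s' then
    bind (f x) (fun b => bind (mapM f s') (fun bs => Ret (b :: bs)))
  else Ret [::].

Fixpoint run Q A B (oracle : Q -> A) (p : qprog Q A B) : B * seq Q :=
  match p with
  | Ret b => (b, [::])
  | Query q c => let: (b, qs) := run oracle (c (oracle q)) in (b, q :: qs)
  end.

Definition nonneg_valuations (R : realType) (n : nat) (G : finType)
    (v : 'I_n -> G -> R) : Prop :=
  forall i g, 0 <= v i g.

Definition bundle_value (R : realType) (G : finType) (u : G -> R)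
    (X : {set G}) : R :=
  \sum_(g in X) u g.

Definition is_allocation (n : nat) (G : finType) (X : 'I_n -> {set G}) : Prop :=
  (forall i j, i != j -> [disjoint X i & X j]) /\ \bigcup_(i < n) X i = [set: G].

Definition is_EFX (R : realType) (n : nat) (G : finType) (alpha : R)
    (v : 'I_n -> G -> R) (X : 'I_n -> {set G}) : Prop :=
  is_allocation X /\
  forall i j, i != j -> X j != finset.set0 -> forall g, g \in X j ->
    alpha * bundle_value (v i) (X j :\ g) <= bundle_value (v i) (X i).

Definition EFX_algorithm (R : realType) (n : nat) (G : finType) (rho : R)
    (alg : ('I_n -> G -> R) -> ('I_n -> {set G})) : Prop :=
  forall v, nonneg_valuations v -> is_EFX rho v (alg v).

(* [pref g g'] reads "g is ranked before g'". *)
Definition strict_linear_order (G : finType) (pref : rel G) : Prop :=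
  [/\ irreflexive pref, transitive pref
    & forall g g', g != g' -> pref g g' || pref g' g].

Definition consistent (R : realType) (G : finType) (pref : rel G) (u : G -> R) :
    Prop :=
  forall g g', pref g g' -> u g' <= u g.

Definition ranking (G : finType) (pref : rel G) : seq G :=
  sort (fun g g' => (g == g') || pref g g') (enum G).

(* Value queries: the query (i, g) returns v_i(g). *)
Definition query (R : realType) (n : nat) (G : finType) (i : 'I_n) (g : G) :
    qprog ('I_n * G) R R :=
  Query (i, g) (fun x => Ret x).

(* Binary search in a sequence [s] along which the values of agent [i] are
   nonincreasing: it returns the prefix of [s] formed by the goods of value at
   least [t]. The fuel [size s] always suffices. *)
Fixpoint bsearch_rec (R : realType) (n : nat) (G : finType) (i : 'I_n) (t : R)
    (fuel : nat) (s : seq G) : qprog ('I_n * G) R (seq G) :=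
  if fuel is fuel'.+1 then
    if drop (size s)./2 s is g :: s2 then
      let s1 := take (size s)./2 s in
      bind (query R i g) (fun x =>
        if t <= x then
          bind (bsearch_rec i t fuel' s2) (fun p => Ret (s1 ++ g :: p))
        else bsearch_rec i t fuel' s1)
    else Ret [::]
  else Ret [::].

Definition bsearch (R : realType) (n : nat) (G : finType) (i : 'I_n) (t : R)
    (s : seq G) : qprog ('I_n * G) R (seq G) :=
  bsearch_rec i t (size s) s.

Definition theta (R : realType) (m k l : nat) : R :=
  m%:R `^ (- (l%:R / k.+1%:R)).

(* [ps] lists the prefixes found by the k binary searches. The set S_{i,l} is
   what the l-th prefix adds to the previous one, the 0-th one being empty. *)
Definition level_set (G : finType) (ps : seq (seq G)) (l : nat) : {set G} :=
  [set g in nth [::] ([::] :: ps) l] :\: [set g in nth [::] ([::] :: ps) l.-1].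

(* [tops] are the goods g_{i,1}, ..., g_{i,n-1}, [vals] their values, and
   [S l] is S_{i,l} for 1 <= l <= k. The goods in no S_{i,l} and not in [tops]
   form S_{i,k+1}. *)
Definition virtual_valuation (R : realType) (G : finType) (k : nat)
    (tops : seq G) (vals : seq R) (S : nat -> {set G}) (g : G) : R :=
  if g \in tops then nth 0 vals (index g tops)
  else if [pick l : 'I_k | g \in S l.+1] is Some l then
    last 0 vals * theta R #|G| k l.+1
  else 0.

(* The binary searches run over the goods ranked after position n-1. Hence a
   good ranked there but tied with g_{i,n-1} falls into S_{i,1}: the upper bound
   v_i(g) < v_{i,n-1} * theta_0 = v_{i,n-1} is read as "g is ranked after
   g_{i,n-1}". With a strict inequality of values such goods would get virtual
   value 0, and the EFX guarantee would fail. Without such ties the two readings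
   agree: see [level_setE] and [level_set_no_tie]. *)
Definition learn_virtual (R : realType) (n : nat) (G : finType) (k : nat)
    (pref : rel G) (i : 'I_n) : qprog ('I_n * G) R (G -> R) :=
  let tops := take n.-1 (ranking pref) in
  let rest := drop n.-1 (ranking pref) in
  bind (mapM (query R i) tops) (fun vals =>
  bind (mapM (fun l => bsearch i (last 0 vals * theta R #|G| k l) rest)
             (iota 1 k)) (fun ps =>
  Ret (virtual_valuation k tops vals (level_set ps)))).

Definition virtual_EFX (R : realType) (n : nat) (G : finType) (k : nat)
    (alg : ('I_n -> G -> R) -> ('I_n -> {set G})) (pref : 'I_n -> rel G) :
    qprog ('I_n * G) R ('I_n -> {set G}) :=
  bind (mapM (fun i => learn_virtual R k (pref i) i) (enum 'I_n)) (fun us =>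
  Ret (alg (fun i => nth (fun=> 0) us i))).

Definition value_oracle (R : realType) (n : nat) (G : finType)
    (v : 'I_n -> G -> R) (q : 'I_n * G) : R := v q.1 q.2.

Definition output (R : realType) (n : nat) (G : finType) (B : Type)
    (v : 'I_n -> G -> R) (p : qprog ('I_n * G) R B) : B :=
  (run (value_oracle v) p).1.

Definition num_queries (R : realType) (n : nat) (G : finType) (B : Type)
    (v : 'I_n -> G -> R) (p : qprog ('I_n * G) R B) (i : 'I_n) : nat :=
  count (fun q => q.1 == i) (run (value_oracle v) p).2.

Lemma run_bind1 Q A B B' (o : Q -> A) (p : qprog Q A B) (f : B -> qprog Q A B') :
  (run o (bind p f)).1 = (run o (f (run o p).1)).1.
Proof.
elim: p => [//|q c IH] /=.
move: (IH (o q)); case: (run o (bind _ _)) => ? ? /= ->.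
by case: (run o (c _)).
Qed.

Lemma run_mapM1 Q A B T (o : Q -> A) (f : T -> qprog Q A B) s :
  (run o (mapM f s)).1 = [seq (run o (f x)).1 | x <- s].
Proof. by elim: s => //= x s IH; rewrite !run_bind1 /= IH. Qed.

Lemma half_le m : (m./2 <= m)%N.
Proof. by rewrite -{2}(odd_double_half m) -addnn addnA leq_addl. Qed.

Lemma bsearchE (R : realType) (n : nat) (G : finType) (v : 'I_n -> G -> R)
    (i : 'I_n) (t : R) (s : seq G) :
  sorted (fun g g' => v i g' <= v i g) s ->
  output v (bsearch i t s) = [seq g <- s | t <= v i g].
Proof.
rewrite /output /bsearch; have : (size s <= size s)%N by [].
move: {2 3}(size s) => f; elim: f s => [|f IH] s; first by case: s.
move=> hs so /=.
have tr : transitive (fun g g' => v i g' <= v i g).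
  by move=> a b c h1 h2; exact: le_trans h2 h1.
have sd := drop_sorted (size s)./2 so.
have st := take_sorted (size s)./2 so.
have szt : size (take (size s)./2 s) = (size s)./2.
  by exact: size_takel (half_le _).
have szd : size (drop (size s)./2 s) = (size s - (size s)./2)%N.
  exact: size_drop.
case E : (drop _ s) => [|g s2] in sd szd *.
  have : (size s)./2 = size s.
    by apply/eqP; rewrite eqn_leq half_le -subn_eq0 -szd.
  move=> h; have : size s = 0%N.
    have := odd_double_half (size s); rewrite h -addnn addnA => /eqP.
    by rewrite -[X in _ == X]add0n eqn_add2r addn_eq0 => /andP[_ /eqP].
  by move/size0nil ->.
have hlt : ((size s)./2 < size s)%N by rewrite -subn_gt0 -szd.
have all1 : all (fun x => v i g <= v i x) (take (size s)./2 s).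
  move: so; rewrite -{1}(cat_take_drop (size s)./2 s) E sorted_pairwise //.
  rewrite pairwise_cat => /andP[/allrelP h _].
  by apply/allP => x xs; apply: h => //; rewrite inE eqxx.
have all2 : all (fun x => v i x <= v i g) s2.
  by move: sd; rewrite /= path_sortedE // => /andP[].
rewrite /query /= [in RHS](_ : s = take (size s)./2 s ++ g :: s2); last first.
  by rewrite -E cat_take_drop.
rewrite filter_cat /=.
case: ifP => [tg|/negbT]; last first.
  rewrite -ltNge => tg /=.
  rewrite (_ : [seq _ <- s2 | _] = [::]) ?cats0.
    have := IH (take (size s)./2 s); rewrite szt -ltnS.
    move=> /(_ (leq_trans hlt hs) st) <-.
    by case: (run _ _).
  apply/eqP; rewrite -(negbK (_ == _)) -has_filter; apply/hasPn => x xs.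
  by rewrite -ltNge; apply: le_lt_trans tg; exact: (allP all2).
have sz2 : (size s2 <= f)%N.
  rewrite -ltnS; apply: leq_trans hs.
  by have := leq_subr (size s)./2 (size s); rewrite -szd.
have := IH s2 sz2 (path_sorted sd) => {}IH.
transitivity ((run (value_oracle v)
  (bind (bsearch_rec i t f s2) (fun p => Ret (take (size s)./2 s ++ g :: p)))).1).
  by case: (run _ _).
rewrite run_bind1 IH /=; congr (_ ++ _); apply/esym/all_filterP.
by apply: sub_all all1 => x /(le_trans tg).
Qed.

Lemma ranking_sorted (R : realType) (G : finType) (pref : rel G) (u : G -> R) :
  strict_linear_order pref -> consistent pref u ->
  sorted (fun g g' => u g' <= u g) (ranking pref).
Proof.
move=> [_ _ tot] con; have : sorted (fun g g' => (g == g') || pref g g') (ranking pref).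
  apply: sort_sorted => g g'; case: (eqVneq g g') => //= gg'; exact: tot.
by apply: sub_sorted => g g' /orP[/eqP-> //|]; exact: con.
Qed.

Lemma level_setE (R : realType) (n k : nat) (G : finType) (v : 'I_n -> G -> R)
    (pref : rel G) (i : 'I_n) (x : R) (l : nat) :
  strict_linear_order pref -> consistent pref (v i) -> (0 < l <= k)%N ->
  let rest := drop n.-1 (ranking pref) in
  let ps := output v (mapM (fun l => bsearch i (x * theta R #|G| k l) rest)
                           (iota 1 k)) in
  level_set ps l =
    [set g in rest | (x * theta R #|G| k l <= v i g) &&
       ((l == 1)%N || (v i g < x * theta R #|G| k l.-1))].
Proof.
move=> lin con /andP[l0 lk] rest ps.
have so : sorted (fun g g' => v i g' <= v i g) rest.
  exact/drop_sorted/ranking_sorted.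
have psE j : (0 < j <= k)%N ->
    nth [::] ([::] :: ps) j = [seq g <- rest | x * theta R #|G| k j <= v i g].
  case: j => //= j jk; rewrite /ps /output run_mapM1 (nth_map 0%N) ?size_iota //.
  by rewrite nth_iota // add1n; exact: bsearchE.
apply/setP => g; rewrite /level_set !inE (psE l) ?l0 // mem_filter.
case: l l0 lk => // -[|l] _ lk; first by rewrite /= andbT andbC.
rewrite [_.-1]/= (psE l.+1) ?(ltnW lk) // mem_filter.
by case: (g \in rest); rewrite ?andbT ?andbF //= -ltNge andbC.
Qed.

Lemma theta0 (R : realType) (m k : nat) : theta R m k 0 = 1.
Proof. by rewrite /theta mul0r oppr0 powRr0. Qed.

Lemma theta_le1 (R : realType) (m k l : nat) : (0 < m)%N -> theta R m k l <= 1.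
Proof.
move=> m0; rewrite /theta -[leRHS](powRr0 m%:R).
by apply: ler_powR; rewrite ?ler1n // oppr_le0 divr_ge0.
Qed.

Lemma level_set_no_tie (R : realType) (n k : nat) (G : finType)
    (v : 'I_n -> G -> R) (pref : rel G) (i : 'I_n) (l : nat) :
  strict_linear_order pref -> consistent pref (v i) -> nonneg_valuations v ->
  (2 <= n <= #|G|)%N -> (0 < l <= k)%N ->
  let tops := take n.-1 (ranking pref) in
  let rest := drop n.-1 (ranking pref) in
  let x := last 0 [seq v i g | g <- tops] in
  let ps := output v (mapM (fun l => bsearch i (x * theta R #|G| k l) rest)
                           (iota 1 k)) in
  {in rest, forall g, v i g != x} ->
  level_set ps l =
    [set g | x * theta R #|G| k l <= v i g < x * theta R #|G| k l.-1].
Proof.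
move=> lin con v0 /andP[n2 nG] lk tops rest x ps notie; rewrite level_setE //.
have so := ranking_sorted lin con.
have tr : transitive (fun g g' => v i g' <= v i g).
  by move=> a b c h1 h2; exact: le_trans h2 h1.
have szr : size (ranking pref) = #|G| by rewrite size_sort -cardE.
have [t0 [ts topsE]] : exists t0 ts, tops = rcons ts t0.
  have : size tops = n.-1.
    by rewrite size_takel // szr (leq_trans (leq_pred n)).
  case/lastP: {x ps notie}tops => [|ts t0 _]; last by exists t0, ts.
  by case: n n2 {i v con v0 nG rest so tr} => // -[].
have xE : x = v i t0 by rewrite /x topsE map_rcons last_rcons.
have memr g : g \in tops ++ rest.
  by rewrite cat_take_drop mem_sort mem_enum.
have /and3P[/allrelP tr_le + _] : [&& allrel (fun g g' => v i g' <= v i g) tops rest,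
    pairwise (fun g g' => v i g' <= v i g) tops
  & pairwise (fun g g' => v i g' <= v i g) rest].
  by rewrite -pairwise_cat -sorted_pairwise // cat_take_drop.
rewrite topsE pairwise_rcons => /andP[/allP ts_le _].
have rest_lt g : g \in rest -> v i g < x.
  move=> gr; rewrite lt_neqAle notie // xE tr_le // topsE.
  by rewrite mem_rcons mem_head.
have tops_ge g : g \in tops -> x <= v i g.
  by rewrite topsE mem_rcons inE xE => /orP[/eqP-> //|/ts_le].
apply/setP => g; rewrite !inE -/rest; case: (boolP (g \in rest)) => gr /=.
  by case: eqP => [->|//]; rewrite /= theta0 mulr1 rest_lt.
apply/esym/negbTE; rewrite negb_and -!leNgt; apply/orP; right.
have gt : g \in tops by move: (memr g); rewrite mem_cat (negbTE gr) orbF.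
apply: le_trans (tops_ge g gt); rewrite -[leRHS]mulr1 ler_wpM2l //.
  by rewrite xE.
by apply: theta_le1; apply: leq_trans nG; apply: ltnW.
Qed.

(* Main.v *)
(* The virtual valuations never exceed the true ones, and with r = m^(1/(k+1))
   they lose at most a factor r, except on the goods of S_{i,k+1}, each worth less
   than x r / m where x = v_{i,n-1}. So agent i's true value for X_j minus g is at
   most r times her virtual value for it, plus x r if it meets S_{i,k+1}. In that
   case rho x is at most her value for X_i: unless X_i has one of her n-1 top goods,
   a pigeonhole argument finds another bundle that still contains a top good after
   the removal of some good, and the virtual EFX property applies to it. The two
   terms cost the factor 2. *)
Require Import Defs.
From mathcomp Require Import all_boot all_order all_algebra.
From mathcomp Require Import all_classical all_reals all_analysis.
From mathcomp Require Import ring lra zify.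

Import Order.TTheory GRing.Theory Num.Theory.
Local Open Scope ring_scope.

(** * Counting the queries of each agent *)

Lemma run_bind2 {Q A B B'} (o : Q -> A) (p : qprog Q A B)
    (f : B -> qprog Q A B') :
  (run o (bind p f)).2 = (run o p).2 ++ (run o (f (run o p).1)).2.
Proof.
elim: p => [//|q c IH] /=.
by move: (IH (o q)); case: (run o (bind _ _)) => ? ? /= ->; case: (run o (c _)).
Qed.

Lemma run_mapM2 {Q A B T} (o : Q -> A) (f : T -> qprog Q A B) s :
  (run o (mapM f s)).2 = flatten [seq (run o (f x)).2 | x <- s].
Proof. by elim: s => //= x s IH; rewrite !run_bind2 /= cats0 IH. Qed.

Lemma size_run_mapM {Q A B T} (o : Q -> A) (f : T -> qprog Q A B) c s :
  (forall x, size (run o (f x)).2 <= c)%N ->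
  (size (run o (mapM f s)).2 <= size s * c)%N.
Proof.
move=> fc; rewrite run_mapM2; elim: s => //= x s IH.
by rewrite size_cat mulSn leq_add.
Qed.

Section Queries.
Context {R : realType} {n : nat} {G : finType}.
Implicit Types (o : 'I_n * G -> R) (i : 'I_n).

Definition asks_only {B} o i (p : qprog ('I_n * G) R B) :=
  all (fun q => q.1 == i) (run o p).2.

Lemma asks_only_bind {B B'} o i (p : qprog ('I_n * G) R B)
    (f : B -> qprog ('I_n * G) R B') :
  asks_only o i p -> (forall b, asks_only o i (f b)) -> asks_only o i (bind p f).
Proof. by rewrite /asks_only run_bind2 all_cat => -> /= ->. Qed.

Lemma asks_only_mapM {B T} o i (f : T -> qprog ('I_n * G) R B) s :
  (forall x, asks_only o i (f x)) -> asks_only o i (mapM f s).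
Proof.
move=> fi; elim: s => //= x s IH.
by apply: asks_only_bind => // b; apply: asks_only_bind.
Qed.

Lemma asks_only_query o i g : asks_only o i (query R i g).
Proof. by rewrite /asks_only /= eqxx. Qed.

Lemma asks_only_bsearch o i t s : asks_only o i (bsearch i t s).
Proof.
rewrite /bsearch; elim: (size s) {2}s => //= f IH {}s.
case: (drop _ s) => // g s2.
apply: asks_only_bind (asks_only_query o i g) _ => x.
by case: ifP => // _; apply: asks_only_bind.
Qed.

Lemma asks_only_learn_virtual o i k pref :
  asks_only o i (learn_virtual R k pref i).
Proof.
apply: asks_only_bind => [|vals].
  by apply: asks_only_mapM => g; apply: asks_only_query.
apply: asks_only_bind => //; apply: asks_only_mapM => l.
exact: asks_only_bsearch.
Qed.

(** After the query at the midpoint, each remaining side has fewer than half of [2 ^ e] goods.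
    Sortedness matters only for the answer, so any oracle is allowed. *)
Lemma size_run_bsearch o i t s e : (size s < 2 ^ e)%N ->
  (size (run o (bsearch i t s)).2 <= e)%N.
Proof.
rewrite /bsearch; elim: (size s) {1 3}s e => //= f IH {}s e se.
case E : (drop _ s) => [//|g s2].
have := congr1 size E; rewrite size_drop /= => szs.
case: e se => [|e]; first by lia.
rewrite expnS => se.
have st : (size (take (size s)./2 s) < 2 ^ e)%N.
  by rewrite size_take; case: ifP; lia.
have s2e : (size s2 < 2 ^ e)%N by lia.
case Er : (run _ _) => [b qs] /=; rewrite ltnS -[qs]/(b, qs).2 -Er.
case: ifP => _; last exact: IH.
by rewrite run_bind2 cats0; exact: IH.
Qed.

Lemma size_run_learn_virtual o i k pref e : (#|G| < 2 ^ e)%N ->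
  (size (run o (learn_virtual R k pref i)).2 <= n + k * e)%N.
Proof.
move=> Ge; rewrite !run_bind2 !size_cat addn0 leq_add //.
  apply: leq_trans (size_run_mapM _ _ 1 _ _) _ => //.
  by rewrite muln1 size_take; case: ifP; lia.
rewrite -[k in (_ <= k * _)%N](size_iota 1); apply: size_run_mapM => l.
apply: size_run_bsearch; apply: leq_ltn_trans Ge.
by rewrite size_drop size_sort -cardE leq_subr.
Qed.

(** The count splits over the agents' learning phases. By [asks_only_learn_virtual] the phase of
    another agent [j] never queries [i]. *)
Lemma num_queries_virtual_EFX (v : 'I_n -> G -> R) k alg pref i e :
  (#|G| < 2 ^ e)%N ->
  (num_queries v (virtual_EFX k alg pref) i <= n + k * e)%N.
Proof.
move=> Ge; rewrite /num_queries run_bind2 /= cats0 run_mapM2.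
rewrite count_flatten -map_comp.
rewrite sumnE big_map big_enum (bigD1 i) //= big1 ?addn0 => [|j ji].
  exact: leq_trans (count_size _ _) (size_run_learn_virtual _ _ _ _ _ Ge).
apply/eqP; rewrite -leqn0 leqNgt -has_count -all_predC.
apply: sub_all (asks_only_learn_virtual (value_oracle v) j k (pref j)).
by move=> q /eqP /= ->.
Qed.

End Queries.

(** * Ratios of the thresholds *)

Lemma theta_mul_root (R : realType) (m k l : nat) : (0 < m)%N ->
  theta R m k l.+1 * m%:R `^ k.+1%:R^-1 = theta R m k l.
Proof.
move=> m0; rewrite /theta -powRD ?pnatr_eq0 -?lt0n ?m0 ?implybT //.
by congr (_ `^ _); rewrite -(natr1 l); field; rewrite addrC natr1 pnatr_eq0.
Qed.

(** The next threshold, at index [k.+1], would be 1/m. This value makes all goods below the last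
    level worth at most x r together. *)
Lemma theta_last (R : realType) (m k : nat) : (0 < m)%N ->
  theta R m k k = m%:R `^ k.+1%:R^-1 / m%:R.
Proof.
move=> m0; rewrite -theta_mul_root // mulrC; congr (_ * _).
by rewrite /theta divff ?pnatr_eq0 // powR_inv1.
Qed.

(** * Virtual valuations as approximations of the true ones *)

Section VirtualEFX.
Context {R : realType} {n : nat} {G : finType}.

Lemma run_learn_virtual (v : 'I_n -> G -> R) k pref i :
  let tops := take n.-1 (ranking pref) in
  let rest := drop n.-1 (ranking pref) in
  let vals := [seq v i g | g <- tops] in
  output v (learn_virtual R k pref i) =
  virtual_valuation k tops vals (level_set (output v
    (mapM (fun l => bsearch i (last 0 vals * theta R #|G| k l) rest) (iota 1 k)))).
Proof. by move=> /=; rewrite /output !run_bind1 /= !run_mapM1. Qed.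

(* [T] stands for the goods g_{i,1}, ..., g_{i,n-1}, [x] for v_{i,n-1} and [r]
   for m^(1/(k+1)); then x * r / m is v_{i,n-1} * theta_k. *)
Definition approximates (r x : R) (T : {set G}) (u w : G -> R) : Prop :=
  [/\ forall g, 0 <= u g <= w g, {in T, forall g, x <= u g}
    & forall g, w g <= r * u g \/ (g \notin T /\ w g <= x * r / #|G|%:R)].

Lemma learn_virtual_approximates (v : 'I_n -> G -> R) k pref i :
  (2 <= n <= #|G|)%N -> (0 < k)%N -> nonneg_valuations v ->
  strict_linear_order pref -> consistent pref (v i) ->
  exists x (T : {set G}), [/\ 0 <= x, #|T| = n.-1
    & approximates (#|G|%:R `^ k.+1%:R^-1) x T
        (output v (learn_virtual R k pref i)) (v i)].
Proof.
move=> /andP[n2 nG] k0 v0 lin con; rewrite run_learn_virtual.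
set tops := take _ _; set rest := drop _ _; set x := last 0 _.
set ps := output _ _; set r := _ `^ _; set vals := [seq _ | _ <- _].
have m0 : (0 < #|G|)%N by lia.
have rge1 : 1 <= r.
  by rewrite -[leLHS](powRr0 #|G|%:R); apply: ler_powR; rewrite ?ler1n ?invr_ge0.
have szr : size (ranking pref) = #|G| by rewrite size_sort -cardE.
have szt : size tops = n.-1 by rewrite size_takel // szr; lia.
have uniq_r : uniq (ranking pref) by rewrite sort_uniq enum_uniq.
have so := ranking_sorted lin con.
have tr : transitive (fun g g' => v i g' <= v i g).
  by move=> a b c h1 h2; exact: le_trans h2 h1.
(* Since n >= 2, [tops] is nonempty, so [x] is the value of its last good and not the default 0. *)
have [t0 [ts topsE]] : exists t0 ts, tops = rcons ts t0.
  case/lastP: tops szt {x ps vals} => [|ts t0 _]; last by exists t0, ts.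
  by move=> /= h; lia.
have xE : x = v i t0 by rewrite /x topsE map_rcons last_rcons.
have x0 : 0 <= x by rewrite xE.
have memr g : (g \in tops) || (g \in rest).
  by rewrite -mem_cat cat_take_drop mem_sort mem_enum.
have [tr_le tops_ge] : {in tops & rest, forall g h, v i h <= v i g} /\
    {in tops, forall g, x <= v i g}.
  have : pairwise (fun g g' => v i g' <= v i g) (tops ++ rest).
    by rewrite -sorted_pairwise // cat_take_drop.
  rewrite pairwise_cat => /and3P[/allrelP h pt _]; split => // g.
  move: pt; rewrite topsE pairwise_rcons xE => /andP[/allP ts_le _].
  by rewrite mem_rcons inE => /orP[/eqP->|/ts_le].
have rest_le g : g \in rest -> v i g <= x.
  by rewrite xE; apply: tr_le; rewrite topsE mem_rcons mem_head.
have th l : theta R #|G| k l.+1 * r = theta R #|G| k l by exact: theta_mul_root.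
exists x, [set g in tops]; split => //.
  by rewrite cardsE; apply/eqP; rewrite -szt; apply/eqP/card_uniqP/take_uniq.
pose u := virtual_valuation k tops vals (level_set ps).
have u_tops g : g \in tops -> u g = v i g.
  move=> gt; rewrite /u /virtual_valuation gt (nth_map g) ?index_mem //.
  by rewrite nth_index.
have levelE l : (l < k)%N -> level_set ps l.+1 =
    [set g in rest | (x * theta R #|G| k l.+1 <= v i g) &&
       ((l.+1 == 1)%N || (v i g < x * theta R #|G| k l))].
  by move=> lk; rewrite [LHS](level_setE x lin con).
have u_rest g : g \notin tops ->
    (exists l, [/\ u g = x * theta R #|G| k l.+1, u g <= v i g
                 & v i g <= x * theta R #|G| k l])
    \/ u g = 0 /\ v i g <= x * theta R #|G| k k.
  move=> gt; have gr : g \in rest by move: (memr g); rewrite (negbTE gt).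
  rewrite /u /virtual_valuation (negbTE gt).
  case: pickP => [[l lk]|none] /=.
    rewrite levelE // !inE gr /= => /andP[vl vu].
    left; exists l; split => //.
    (* The first level has no upper threshold because of ties; there the ranking itself gives
       [v i g <= x]. *)
    by case: l vu {lk vl} => [_|l /ltW //]; rewrite theta0 mulr1 rest_le.
  right; split => //; rewrite leNgt; apply/negP => /ltW vg.
  (* If [g] reached the k-th threshold, the least positive index whose threshold it reaches would be
     its level, against [none]. *)
  have ex : exists l, (0 < l)%N && (x * theta R #|G| k l <= v i g).
    by exists k; rewrite k0.
  case: (ex_minnP ex) => -[|l] // /andP[_ vl] lmin.
  have lk : (l < k)%N by apply: lmin; rewrite k0.
  have := none (Ordinal lk); rewrite /= levelE // !inE gr vl /= => /negbT.
  rewrite negb_or -leNgt => /andP[l1 vl'].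
  by have := lmin l; rewrite lt0n l1 vl' ltnn => /(_ isT).
have th0 l : 0 <= theta R #|G| k l by exact: powR_ge0.
split => g; rewrite -/u.
- case: (boolP (g \in tops)) => [/u_tops->|/u_rest[[l [ug -> _]]|[-> _]]].
  + by rewrite v0 lexx.
  + by rewrite ug mulr_ge0.
  + by rewrite lexx v0.
- by rewrite inE => gt; rewrite u_tops ?tops_ge.
- rewrite inE; case: (boolP (g \in tops)) => [/u_tops->|].
    by left; apply: ler_peMl.
  case/u_rest => [[l [-> _ vl]]|[_ vl]].
  + by left; rewrite mulrC -mulrA th.
  + by right; split=> //; rewrite -mulrA -theta_last.
Qed.

(** * Transfer of EFX from virtual to true valuations *)

Lemma ler_bundle_value {u w : G -> R} (X : {set G}) :
  (forall g, u g <= w g) -> bundle_value u X <= bundle_value w X.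
Proof. by move=> uw; apply: ler_sum. Qed.

Lemma bundle_value_ge (u : G -> R) (X : {set G}) g :
  (forall h, 0 <= u h) -> g \in X -> u g <= bundle_value u X.
Proof.
by move=> u0 gX; rewrite /bundle_value (bigD1 g) //= lerDl sumr_ge0.
Qed.

(* If [X i] misses all of [T], the [n - 1] goods of [T] go to the other agents:
   either [X j] gets one besides [h], or some other agent gets two of them. *)
Lemma EFX_value_ge (rho x : R) (u : 'I_n -> G -> R) (T : {set G})
    (X : 'I_n -> {set G}) (i j : 'I_n) (h : G) :
  0 <= rho <= 1 -> 0 <= x -> nonneg_valuations u -> #|T| = n.-1 ->
  {in T, forall g, x <= u i g} -> is_EFX rho u X ->
  i != j -> h \in X j -> h \notin T -> rho * x <= bundle_value (u i) (X i).
Proof.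
move=> /andP[rho0 rho1] x0 u0 cT Tx [[_ cover] efx] ij hj hT.
(* Removing [g] leaves the top good [t] in the bundle, so EFX against [j'] already gives the
   bound. *)
have take_one j' g t : i != j' -> g \in X j' -> t \in T -> t \in X j' -> t != g ->
    rho * x <= bundle_value (u i) (X i).
  move=> ij' gj' tT tj' tg.
  have ne : X j' != finset.set0 by apply/set0Pn; exists g.
  apply: le_trans (efx i j' ij' ne g gj'); rewrite ler_wpM2l //.
  apply: le_trans (Tx t tT) _.
  by apply: bundle_value_ge; rewrite ?inE ?tg.
have owner_ex g : exists j, g \in X j.
  have : g \in \bigcup_(i < n) X i by rewrite cover inE.
  by case/bigcupP => j' _; exists j'.
have [owner ownerP] := boolp.choice owner_ex.
case: (boolP [exists t in T, owner t == i]) => [/exists_inP[t tT /eqP ti]|noi].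
  apply: le_trans (_ : x <= _); first by rewrite ler_piMl.
  by apply: le_trans (Tx t tT) (bundle_value_ge _ _ _ _ _) => //; rewrite -ti.
have {}noi t : t \in T -> i != owner t.
  by move=> tT; apply: contra noi => /eqP ->; apply/exists_inP; exists t.
case: (boolP [exists t in T, owner t == j]) => [/exists_inP[t tT /eqP tj]|noj].
  apply: (take_one j h t) => //; first by rewrite -tj.
  by apply: contraNneq hT => <-.
(* The n-1 top goods now belong to the n-2 agents other than [i] and [j], so [owner] is not
   injective on [T]. Of two goods with the same owner, one is removed and the other stays. *)
case: (boolP (dinjectiveb owner (mem T))) => [/dinjectiveP inj|].
  have : (#|owner @: T| <= #|~: [set i; j]|)%N.
    apply/subset_leq_card/fintype.subsetP => _ /imsetP[t tT ->].
    rewrite !inE negb_or eq_sym noi //=.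
    by apply: contra noj => ?; apply/exists_inP; exists t.
  rewrite card_in_imset //.
  have := cardsC [set i; j]; rewrite cards2 ij card_ord cT; lia.
move=> /dinjectivePn[t tT [t' /andP[t't t'T] ow]].
by apply: (take_one (owner t) t t'); rewrite ?noi // ow.
Qed.

Lemma is_EFX_of_approximation (rho r : R) (u v : 'I_n -> G -> R)
    (X : 'I_n -> {set G}) :
  0 <= rho <= 1 -> 0 < r ->
  (forall i, exists x (T : {set G}),
    [/\ 0 <= x, #|T| = n.-1 & approximates r x T (u i) (v i)]) ->
  is_EFX rho u X -> is_EFX (rho / (2 * r)) v X.
Proof.
move=> rho01 r0 apx uX; have [alloc efx] := uX; split=> // i j ij ne g gj.
have /andP[rho0 rho1] := rho01.
have u0 : nonneg_valuations u.
  by move=> i' h; have [x [T [_ _ [uv _ _]]]] := apx i'; case/andP: (uv h).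
have [x [T [x0 cT [uv Tx vle]]]] := apx i.
have m0 : (0 < #|G|)%N by apply/card_gt0P; exists g.
have mR : 0 < #|G|%:R :> R by rewrite ltr0n.
have uvX : bundle_value (u i) (X i) <= bundle_value (v i) (X i).
  by apply: ler_bundle_value => h; case/andP: (uv h).
have Ug := efx i j ij ne g gj.
set D := X j :\ g in Ug *.
have U0 : 0 <= bundle_value (u i) (X i) by apply: sumr_ge0.
rewrite mulrAC ler_pdivrMr; last by rewrite mulr_gt0.
(* If no good of [D] is [low], the factor [r] alone relates the two values of [D]. *)
pose low := [pred h | (h \notin T) && (v i h <= x * r / #|G|%:R)].
case: (boolP [exists h in D, low h]) => [/exists_inP[h]|nolow].
  rewrite !inE => /andP[_ hj] /andP[hT _].
  have xX := EFX_value_ge rho x u T X i j h rho01 x0 u0 cT Tx uX ij hj hT.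
  have vD : bundle_value (v i) D <= r * bundle_value (u i) D + x * r.
    apply: (@le_trans _ _ (\sum_(h in D) (r * u i h + x * r / #|G|%:R))).
      apply: ler_sum => g' _; case: (vle g') => [|[_]] h'.
        by rewrite ler_wpDr // divr_ge0 ?mulr_ge0 // ltW.
      by rewrite ler_wpDl // mulr_ge0 // ltW.
    (* [D] has at most m goods, each with an additive error of x r / m. *)
    rewrite big_split /= -mulr_sumr lerD2l sumr_const.
    rewrite -[leRHS](@divfK _ #|G|%:R) ?gt_eqF //.
    rewrite mulr_natr ler_wpMn2l ?max_card // divr_ge0 ?mulr_ge0 // ltW //.
  apply: le_trans (ler_wpM2l rho0 vD) _.
  (* Both [rho * bundle_value (u i) D] and [rho * x] are at most the virtual value of [X i], by [Ug]
     and [xX]; each enters with factor [r], for a total of [2 * r]. *)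
  nra.
have vD : bundle_value (v i) D <= r * bundle_value (u i) D.
  rewrite /bundle_value mulr_sumr; apply: ler_sum => h hD.
  case: (vle h) => // -[hT hl]; case/negP: nolow; apply/exists_inP.
  by exists h => //=; rewrite hT.
apply: le_trans (ler_wpM2l rho0 vD) _.
nra.
Qed.

End VirtualEFX.

(** * Logarithmic query bound and conclusion *)

Lemma natr_trunc_log_le (R : realType) (m : nat) : (0 < m)%N ->
  (trunc_log 2 m)%:R <= ln m%:R / ln 2 :> R.
Proof.
move=> m0; rewrite ler_pdivlMr ?ln_gt0 ?ltr1n // mulr_natl -lnXn //.
by rewrite ler_ln ?posrE ?exprn_gt0 ?ltr0n // -natrX ler_nat trunc_logP.
Qed.

Theorem theorem3p1 (R : realType) :
  exists C : R,
  forall (n k : nat) (G : finType) (rho : R)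
    (alg : ('I_n -> G -> R) -> ('I_n -> {set G}))
    (v : 'I_n -> G -> R) (pref : 'I_n -> rel G),
  (2 <= n)%N -> (n <= #|G|)%N -> (1 <= k)%N -> 0 <= rho <= 1 ->
  EFX_algorithm rho alg ->
  nonneg_valuations v ->
  (forall i, strict_linear_order (pref i)) ->
  (forall i, consistent (pref i) (v i)) ->
  (forall i, (num_queries v (virtual_EFX k alg pref) i)%:R
             <= C * (n%:R + k%:R * ln #|G|%:R)) /\
  is_EFX (rho / (2 * #|G|%:R `^ (k.+1%:R^-1))) v
         (output v (virtual_EFX k alg pref)).
Proof.
have ln2 : 0 < ln 2 :> R by rewrite ln_gt0 ?ltr1n.
(* The 1 pays for the n top queries; 2 / ln 2 pays for a binary search, which takes at most [e.+1]
   queries with e the rounded-down binary logarithm of m. *)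
exists (1 + 2 / ln 2) => n k G rho alg v pref n2 nG k0 rho01 algP v0 lin con.
have m0 : (0 < #|G|)%N by lia.
split=> [i|].
  pose e := trunc_log 2 #|G|.
  have q : (num_queries v (virtual_EFX k alg pref) i <= n + k * e.+1)%N.
    exact/num_queries_virtual_EFX/trunc_log_ltn.
  have e1 : e.+1%:R <= 2 / ln 2 * ln #|G|%:R :> R.
    (* From m >= n >= 2 it follows that e >= 1, so e + 1 <= 2 e and no additive constant remains. *)
    have e_gt0 : (0 < e)%N by rewrite trunc_log_gt0; lia.
    apply: (@le_trans _ _ (2 * e%:R)); first by rewrite -natrM ler_nat; lia.
    by rewrite mulrAC -mulrA ler_wpM2l // natr_trunc_log_le.
  apply: le_trans (_ : (n + k * e.+1)%:R <= _); first by rewrite ler_nat.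
  have c0 : 0 < 2 / ln 2 :> R by rewrite divr_gt0.
  have ke := ler_wpM2l (ler0n R k) e1.
  have l0 : 0 <= ln #|G|%:R :> R by rewrite ln_ge0 ?ler1n.
  rewrite natrD natrM mulrDr lerD //.
    by rewrite ler_peMl // lerDl ltW.
  apply: le_trans ke _; rewrite mulrCA ler_wpM2r ?lerDr // mulr_ge0 //.
rewrite /output run_bind1 run_mapM1 /=.
set u := fun i : 'I_n => nth _ _ i.
have uE i : u i = output v (learn_virtual R k (pref i) i).
  by rewrite /u (nth_map i) ?size_enum_ord // nth_ord_enum.
have apx i : exists x (T : {set G}), [/\ 0 <= x, #|T| = n.-1
    & approximates (#|G|%:R `^ k.+1%:R^-1) x T (u i) (v i)].
  by rewrite uE; apply: learn_virtual_approximates => //; rewrite n2.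
(* The black box guarantees EFX only on nonnegative inputs. *)
have u0 : nonneg_valuations u.
  by move=> i g; have [x [T [_ _ [uv _ _]]]] := apx i; case/andP: (uv g).
apply: is_EFX_of_approximation apx (algP u u0) => //.
by rewrite powR_gt0 ?ltr0n.
Qed.
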